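(* Let $z\in\mathbb{C}^n$, $\tilde z=[z^T,1]^T\in\mathbb{C}^{n+1}$, and for $i=1,\dots,m$ let $(\mu_{d_i},\Gamma_{d_i},J_{d_i})$ be the prescribed mean, covariance and pseudo-covariance of $d_i$. For any $p_i\in[0.5,1)$, the symmetric distributionally robust complex chance constraint $$\inf_{d_i\sim(\mu_{d_i},\Gamma_{d_i},J_{d_i})_S}\mathbb{P}[\mathrm{Re}(d_i\tilde z)\le 0]\ge p_i,\qquad i=1,\dots,m,$$ is equivalent to $$k_{p_i}\,\sigma_{\varphi_i(z)}+\mu_{\varphi_i(z)}\le 0,\qquad k_{p_i}=\frac{1}{\sqrt{2(1-p_i)}},\qquad i=1,\dots,m,$$ where $\varphi_i(z)=\mathrm{Re}(d_i\tilde z)$.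
   Context: A random vector $\xi\in\mathbb{C}^N$ is centrally symmetric if its distribution $\mu_\xi$ satisfies $\mu_\xi(A)=\mu_\xi(-A)$ for all Borel sets $A\subseteq\mathbb{C}^N$; $d_i$ is symmetric around its mean if $d_i-\mu_{d_i}$ is centrally symmetric. $(\mu_{d_i},\Gamma_{d_i},J_{d_i})_S$ denotes the (nonempty) family of all probability distributions on $\mathbb{C}^{n+1}$ that are symmetric around their mean and have mean $\mu_{d_i}$, covariance matrix $\Gamma_{d_i}$ (entries $\mathbb{E}[((d_i)_j-\mathbb{E}(d_i)_j)\overline{((d_i)_k-\mathbb{E}(d_i)_k)}]$) and pseudo-covariance matrix $J_{d_i}$ (entries $\mathbb{E}[((d_i)_j-\mathbb{E}(d_i)_j)((d_i)_k-\mathbb{E}(d_i)_k)]$). The product $d_i\tilde z=\sum_j(d_i)_j\tilde z_j$ is without conjugation. $\mu_{\varphi_i(z)}$ and $\sigma_{\varphi_i(z)}\ge 0$ are the mean and standard deviation of $\varphi_i(z)$, which are the same for every distribution in the family.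
   Formalization: The equivalence is proved for all p_i in (0.5,1); at p_i=0.5 only ''inequality implies chance constraint'' is claimed, since the converse fails there (mean 0, positive standard deviation: symmetry gives probability at least 1/2, but k·σ+μ>0). *)

(* Defs.v *)
From HB Require Import structures.
From mathcomp Require Import all_boot all_order all_algebra.
From mathcomp Require Import complex.
From mathcomp Require Import all_classical all_reals all_analysis.

Set Implicit Arguments.
Unset Strict Implicit.
Unset Printing Implicit Defensive.

Import Order.TTheory GRing.Theory Num.Theory numFieldNormedType.Exports.

Local Open Scope classical_set_scope.
Local Open Scope ring_scope.
Local Open Scope complex_scope.

(* [R[i]] carries no topology in the libraries: give it the one of the modulus,
   so that ['rV[R[i]]_N] gets the product topology. *)
HB.instance Definition _ (R : realType) := NormedModule.copy R[i] R[i]^o.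

(* C^N (as row vectors) with its Borel sigma-algebra *)
Notation cvec R N := (g_sigma_algebraType (@open 'rV[R[i]]_N)).

Notation cdistribution R N := (probability (cvec R N) R).

(* Expectation of a complex random variable. [fine] is harmless: this is only
   used when real and imaginary parts are integrable. *)
Definition cexpectation d (T : measurableType d) (R : realType)
    (P : probability T R) (X : T -> R[i]) : R[i] :=
  fine 'E_P[fun w => complex.Re (X w)] +i* fine 'E_P[fun w => complex.Im (X w)].

Section moments.
Context (R : realType) (N : nat) (P : cdistribution R N).

Definition square_integrable : Prop := forall j : 'I_N,
  ((fun d : cvec R N => complex.Re (d 0 j)) \in Lfun P 2%:E) /\
  ((fun d : cvec R N => complex.Im (d 0 j)) \in Lfun P 2%:E).

Definition mean : 'rV[R[i]]_N :=
  \row_j cexpectation P (fun d : cvec R N => d 0 j).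

Definition covariance_mx : 'M[R[i]]_N :=
  \matrix_(j, k) cexpectation P (fun d : cvec R N =>
    (d 0 j - mean 0 j) * conjc (d 0 k - mean 0 k)).

Definition pseudo_covariance_mx : 'M[R[i]]_N :=
  \matrix_(j, k) cexpectation P (fun d : cvec R N =>
    (d 0 j - mean 0 j) * (d 0 k - mean 0 k)).

End moments.

Definition centrally_symmetric (R : realType) (N : nat)
    (nu : set (cvec R N) -> \bar R) : Prop :=
  forall A : set (cvec R N), measurable A ->
    nu A = nu [set - (x : 'rV[R[i]]_N) | x in A].

Definition symmetric_around_mean (R : realType) (N : nat)
    (P : cdistribution R N) : Prop :=
  centrally_symmetric
    (pushforward P (fun d : cvec R N => (d - mean P : cvec R N))).

Definition symmetric_family (R : realType) (N : nat)
    (mu : 'rV[R[i]]_N) (Gamma J : 'M[R[i]]_N) : set (cdistribution R N) :=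
  [set P | [/\ square_integrable P, symmetric_around_mean P, mean P = mu,
               covariance_mx P = Gamma & pseudo_covariance_mx P = J]].

Definition ztilde (R : realType) (n : nat) (z : 'cV[R[i]]_n) :
    'cV[R[i]]_(n + 1) := col_mx z 1%:M.

Definition phi (R : realType) (n : nat) (z : 'cV[R[i]]_n)
    (d : cvec R (n + 1)) : R :=
  complex.Re (((d : 'rV[R[i]]_(n + 1)) *m ztilde z) 0 0).

Definition phi_mean (R : realType) (n : nat) (P : cdistribution R (n + 1))
    (z : 'cV[R[i]]_n) : R := fine 'E_P[phi z].

Definition phi_std (R : realType) (n : nat) (P : cdistribution R (n + 1))
    (z : 'cV[R[i]]_n) : R := Num.sqrt (fine (variance P (phi z))).

Definition worst_case_probability (R : realType) (n : nat)
    (F : set (cdistribution R (n + 1))) (z : 'cV[R[i]]_n) : \bar R :=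
  ereal_inf [set P [set d | phi z d <= 0] | P in F].

Definition kfactor (R : realType) (p : R) : R := (Num.sqrt (2 * (1 - p)))^-1.

(* Main.v *)
(* Sufficiency is a symmetric Chebyshev inequality: the two tails of
   [phi - E phi] have the same mass, so each has mass at most
   [Var phi / (2 t^2)] beyond distance [t].
   Necessity, when [sigma > 0]: let [c] be the regression vector
   [Cov(d, phi) / Var phi] and replace [d] by [d + (S - (phi d - E phi)) c],
   where [S] is independent of [d], takes the values [s] and [- s] with
   probability [q] each and [0] otherwise, and [2 q s^2 = sigma^2]. Symmetry
   and all first and second moments are preserved, while [phi] now equals
   [mu + S]. If [k sigma + mu > 0], some [s < k sigma] exceeds both [- mu] and
   [sigma]; then [q > 1 - p], so [phi > 0] has probability more than [1 - p]. *)

From HB Require Import structures.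
Require Import Defs.
From mathcomp Require Import all_boot all_order all_algebra.
From mathcomp Require Import complex.
From mathcomp Require Import all_classical all_reals all_analysis.
From mathcomp Require Import measurable_realfun.
From mathcomp Require Import ring lra.
Set Implicit Arguments.
Unset Strict Implicit.
Unset Printing Implicit Defensive.

Import Order.TTheory GRing.Theory Num.Theory numFieldNormedType.Exports.
Local Open Scope classical_set_scope.
Local Open Scope ring_scope.

Local Notation Ex P X := (fine (expectation P X)).

(** * Linearity of the real-valued expectation *)

Section real_expectation.
Context d (T : measurableType d) (R : realType) (P : probability T R).
Implicit Types f g : T -> R.

Lemma Lfun21 f : f \in Lfun P 2%:E -> f \in Lfun P 1%E.
Proof. by apply: Lfun_subset12; rewrite fin_num_measure. Qed.

Lemma LfunD r f g : 1 <= r -> f \in Lfun P r%:E -> g \in Lfun P r%:E ->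
  (fun x => f x + g x) \in Lfun P r%:E.
Proof. by move=> r1 Pf Pg; apply: (Lfun_addr_closed _ _).2. Qed.

Lemma LfunZ r (k : R) f : 1 <= r -> f \in Lfun P r%:E ->
  (fun x => k * f x) \in Lfun P r%:E.
Proof.
move=> r1 Pf; under eq_fun do rewrite mulrC.
exact: Lfun_scale.
Qed.

Lemma LfunM f g : f \in Lfun P 2%:E -> g \in Lfun P 2%:E ->
  (fun x => f x * g x) \in Lfun P 1%:E.
Proof. exact: Lfun2_mul_Lfun1. Qed.

Lemma LfunD_cst r f (k : R) : 1 <= r -> f \in Lfun P r%:E ->
  (fun x => f x + k) \in Lfun P r%:E.
Proof. by move=> r1 Pf; apply: LfunD => //; exact: Lfun_cst. Qed.

Lemma Lfun_lincomb r (I : finType) (a : I -> R) (f : I -> T -> R) : 1 <= r ->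
    (forall i, f i \in Lfun P r%:E) ->
  (fun x => \sum_i a i * f i x) \in Lfun P r%:E.
Proof.
move=> r1 Pf; elim: (index_enum I) => [|i s IHs].
  by under eq_fun do rewrite big_nil; exact: Lfun_cst.
under eq_fun do rewrite big_cons.
by apply: LfunD => //; exact: LfunZ.
Qed.

Lemma Ex_cst (k : R) : Ex P (fun=> k) = k.
Proof. by rewrite expectation_cst. Qed.

Lemma ExD f g : f \in Lfun P 1%E -> g \in Lfun P 1%E ->
  Ex P (fun x => f x + g x) = Ex P f + Ex P g.
Proof.
move=> Pf Pg; rewrite -fineD ?expectation_fin_num//.
by rewrite -expectationD.
Qed.

Lemma ExZ (k : R) f : f \in Lfun P 1%E -> Ex P (fun x => k * f x) = k * Ex P f.
Proof.
move=> Pf; under eq_fun do rewrite mulrC.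
by rewrite (expectationZl k Pf) fineM ?expectation_fin_num.
Qed.

Lemma ExB f g : f \in Lfun P 1%E -> g \in Lfun P 1%E ->
  Ex P (fun x => f x - g x) = Ex P f - Ex P g.
Proof.
move=> Pf Pg; rewrite -fineB ?expectation_fin_num//.
by rewrite -expectationB.
Qed.

Lemma Ex_lincomb (I : finType) (a : I -> R) (f : I -> T -> R) :
    (forall i, f i \in Lfun P 1%E) ->
  Ex P (fun x => \sum_i a i * f i x) = \sum_i a i * Ex P (f i).
Proof.
move=> Pf.
suff: (fun x => \sum_i a i * f i x) \in Lfun P 1%E /\
    Ex P (fun x => \sum_i a i * f i x) = \sum_i a i * Ex P (f i) by case.
elim: (index_enum I) => [|i s [IHs1 IHs2]].
  under eq_fun do rewrite big_nil.
  by rewrite Ex_cst big_nil; split => //; exact: Lfun_cst.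
under eq_fun do rewrite big_cons; split.
  by apply: LfunD => //; exact: LfunZ.
by rewrite ExD ?ExZ ?big_cons ?IHs2//; exact: LfunZ.
Qed.

End real_expectation.

(** * Finite mixtures of probability measures *)

Section mixture.
Context d (T : measurableType d) (R : realType).
Context (n : nat) (w : nat -> {nonneg R}) (Q : nat -> probability T R).
Hypothesis w1 : \sum_(k < n) (w k)%:num = 1.

Definition mixture := msum (fun k => mscale (w k) (Q k)) n.

HB.instance Definition _ := Measure.on mixture.

Lemma mixtureE A : mixture A = (\sum_(k < n) ((w k)%:num)%:E * Q k A)%E.
Proof. by []. Qed.

Let mixture_setT : mixture setT = 1%E.
Proof.
rewrite mixtureE; under eq_bigr do rewrite probability_setT mule1.
by rewrite sumEFin w1.
Qed.

HB.instance Definition _ :=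
  Measure_isProbability.Build _ _ _ mixture mixture_setT.

Definition mixture_probability : probability T R := mixture.

Lemma ge0_integral_mixture (f : T -> \bar R) :
    measurable_fun setT f -> (forall x, 0 <= f x)%E ->
  (\int[mixture]_x f x = \sum_(k < n) ((w k)%:num)%:E * \int[Q k]_x f x)%E.
Proof.
move=> mf f0; rewrite ge0_integral_measure_sum//.
by apply: eq_bigr => k _; rewrite ge0_integral_mscale.
Qed.

Lemma Lfun_mixture r (f : T -> R) : 1 <= r ->
    measurable_fun setT f -> (forall k : 'I_n, f \in Lfun (Q k) r%:E) ->
  f \in Lfun mixture r%:E.
Proof.
move=> r1 mf Qf; rewrite inE; apply/andP; split; rewrite inE//=.
rewrite /finite_norm unlock poweR_lty//= ge0_integral_mixture; last 2 first.
- apply/measurable_EFinP.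
  apply: (@measurableT_comp _ _ _ _ _ _ (@powR R ^~ r)) => //.
  exact: measurableT_comp.
- by move=> x; rewrite lee_fin powR_ge0.
apply: lte_sum_pinfty => k _; apply: lte_mul_pinfty => //.
exact/integrable_lty/Lfun_integrable.
Qed.

Lemma Ex_mixture (f : T -> R) :
    measurable_fun setT f -> (forall k : 'I_n, f \in Lfun (Q k) 1%E) ->
  Ex mixture_probability f = \sum_(k < n) (w k)%:num * Ex (Q k) f.
Proof.
move=> mf Qf; rewrite unlock.
have mEf : measurable_fun setT (EFin \o f) by exact/measurable_EFinP.
have iQ k : (k < n)%N -> (Q k).-integrable setT (EFin \o f).
  by move=> kn; apply/Lfun1_integrable; exact: (Qf (Ordinal kn)).
rewrite integralE !ge0_integral_mixture//; last 2 first.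
- exact: measurable_funeneg.
- exact: measurable_funepos.
(* [fine] respects sums and differences only for finite values, so the positive and negative parts
   are first shown to have finite integral under each component. *)
have pE k : (k < n)%N -> (\int[Q k]_x (EFin \o f)^\+ x)%E \is a fin_num.
  by move=> kn; exact: integrable_pos_fin_num (iQ _ kn).
have nE k : (k < n)%N -> (\int[Q k]_x (EFin \o f)^\- x)%E \is a fin_num.
  by move=> kn; exact: integrable_neg_fin_num (iQ _ kn).
rewrite fineB; last 2 first.
- by apply/sum_fin_numP => k _ _; rewrite fin_numM// pE.
- by apply/sum_fin_numP => k _ _; rewrite fin_numM// nE.
rewrite -!sum_fine; last 2 first.
- by move=> k _; rewrite fin_numM// nE.
- by move=> k _; rewrite fin_numM// pE.
under [RHS]eq_bigr => k _ do
  rewrite integralE fineB ?pE ?nE// mulrBr -[(w k)%:num]/(fine (_%:E))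
    -!fineM ?pE ?nE//.
by rewrite sumrB.
Qed.

End mixture.

(** * Image laws and their three-point mixtures *)

Section image_distribution.
Context d d' (T : measurableType d) (T' : measurableType d') (R : realType).
Context (P : probability T R) (X : {mfun T >-> T'}).

Lemma Lfun_distribution r (f : T' -> R) : 1 <= r -> measurable_fun setT f ->
  (fun x => f (X x)) \in Lfun P r%:E -> f \in Lfun (distribution P X) r%:E.
Proof.
move=> r1 mf Pf; rewrite inE; apply/andP; split; rewrite inE//=.
rewrite /finite_norm unlock poweR_lty//= ge0_integral_distribution; last 2 first.
- apply/measurable_EFinP.
  apply: (@measurableT_comp _ _ _ _ _ _ (@powR R ^~ r)) => //.
  exact: measurableT_comp.
- by move=> x; rewrite lee_fin powR_ge0.
exact/integrable_lty/(Lfun_integrable r1 Pf).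
Qed.

Lemma Ex_distribution (f : T' -> R) : measurable_fun setT f ->
    (fun x => f (X x)) \in Lfun P 1%E ->
  Ex (distribution P X) f = Ex P (fun x => f (X x)).
Proof.
move=> mf Pf; rewrite unlock integral_distribution//.
  exact/measurable_EFinP.
exact/Lfun1_integrable.
Qed.

End image_distribution.

(** This encodes a choice among three transformations made independently of the sample point,
    without a product space: conditioning on the choice turns the resulting law into a mixture of
    three image laws of [P]. The last two clauses reduce integrability and moments under [M] to
    those under [P]. *)
Lemma three_point_mixture d d' (T : measurableType d) (T' : measurableType d')
    (R : realType) (P : probability T R) (X Y Z : {mfun T >-> T'}) (q : R) :
    0 <= q -> 2 * q <= 1 ->
  exists M : probability T' R,
    [/\ forall A, M A = (q%:E * P (X @^-1` A) +
          ((1 - 2 * q)%:E * P (Y @^-1` A) + q%:E * P (Z @^-1` A)))%E,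
        forall r (f : T' -> R), 1 <= r -> measurable_fun setT f ->
          (fun x => f (X x)) \in Lfun P r%:E ->
          (fun x => f (Y x)) \in Lfun P r%:E ->
          (fun x => f (Z x)) \in Lfun P r%:E -> f \in Lfun M r%:E &
        forall f : T' -> R, measurable_fun setT f ->
          (fun x => f (X x)) \in Lfun P 1%E ->
          (fun x => f (Y x)) \in Lfun P 1%E ->
          (fun x => f (Z x)) \in Lfun P 1%E ->
          Ex M f = q * Ex P (fun x => f (X x)) +
            ((1 - 2 * q) * Ex P (fun x => f (Y x)) +
             q * Ex P (fun x => f (Z x)))].
Proof.
move=> q0 q1; have q1' : 0 <= 1 - 2 * q by lra.
(* Index 1 is the middle branch [Y], of weight [1 - 2 * q]; indices from 3 on lie outside the sum,
   so their values are arbitrary. *)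
pose w k := if k == 1%N then NngNum q1' else NngNum q0.
pose U k := match k with 0 => X | 1 => Y | _ => Z end.
have w1 : \sum_(k < 3) (w k)%:num = 1.
  by rewrite !big_ord_recl big_ord0 /=; lra.
exists (mixture_probability (fun k => distribution P (U k)) w1); split.
- by move=> A; rewrite [LHS]mixtureE !big_ord_recl big_ord0 adde0.
- move=> r f r1 mf fX fY fZ; apply: Lfun_mixture => // -[[|[|k]] kn];
    exact: Lfun_distribution.
- move=> f mf fX fY fZ; rewrite Ex_mixture//.
    by rewrite !big_ord_recl big_ord0 addr0 !Ex_distribution.
  move=> -[[|[|k]] kn]; exact: (@Lfun_distribution _ _ _ _ _ _ _ 1).
Qed.

(** * Real coordinates and real linear forms on C^N *)

Section real_coordinates.
Context (R : realType) (N : nat).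
Implicit Types (t u : 'I_N * bool) (x y : 'rV[R[i]]_N) (a : 'I_N * bool -> R).

(* The coordinates of C^N seen as R^(2N): [(j, true)] is the imaginary part. *)
Definition rcoord t x : R :=
  if t.2 then complex.Im (x 0 t.1) else complex.Re (x 0 t.1).

Lemma rcoordD t x y : rcoord t (x + y) = rcoord t x + rcoord t y.
Proof. by rewrite /rcoord mxE; case: t.2; case: (x 0 _) (y 0 _) => ? ? []. Qed.

Lemma rcoordN t x : rcoord t (- x) = - rcoord t x.
Proof. by rewrite /rcoord mxE; case: t.2; case: (x 0 _). Qed.

Lemma rcoordB t x y : rcoord t (x - y) = rcoord t x - rcoord t y.
Proof. by rewrite rcoordD rcoordN. Qed.

Lemma rcoordZ t (r : R) x : rcoord t (r%:C%C *: x) = r * rcoord t x.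
Proof.
rewrite /rcoord mxE; case: t.2; case: (x 0 _) => u v /=.
  by rewrite mul0r addr0.
by rewrite mul0r subr0.
Qed.

Lemma rcoord_inj x y : (forall t, rcoord t x = rcoord t y) -> x = y.
Proof.
move=> xy; apply/rowP => j; have := xy (j, true); have := xy (j, false).
by rewrite /rcoord/=; case: (x 0 j) (y 0 j) => ? ? [? ?] /= -> ->.
Qed.

Definition rlform a x : R := \sum_t a t * rcoord t x.

Lemma rlformD a x y : rlform a (x + y) = rlform a x + rlform a y.
Proof.
by rewrite -big_split; apply: eq_bigr => t _; rewrite rcoordD mulrDr.
Qed.

Lemma rlformN a x : rlform a (- x) = - rlform a x.
Proof. by rewrite -sumrN; apply: eq_bigr => t _; rewrite rcoordN mulrN. Qed.

Lemma rlformB a x y : rlform a (x - y) = rlform a x - rlform a y.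
Proof. by rewrite rlformD rlformN. Qed.

Lemma rlformZ a (r : R) x : rlform a (r%:C%C *: x) = r * rlform a x.
Proof.
by rewrite mulr_sumr; apply: eq_bigr => t _; rewrite rcoordZ mulrCA.
Qed.

End real_coordinates.

(** * First and second moments in real coordinates *)

Section real_moments.
Context (R : realType) (N : nat) (P : cdistribution R N).
Hypothesis P2 : square_integrable P.
Implicit Types (t u : 'I_N * bool) (a : 'I_N * bool -> R).

Lemma rcoord_mean t : rcoord t (mean P) = Ex P (fun d : cvec R N => rcoord t d).
Proof. by case: t => j b; rewrite /rcoord !mxE /=; case: b. Qed.

Lemma Lfun2_rcoord t : (fun d : cvec R N => rcoord t d) \in Lfun P 2%:E.
Proof. by case: t => j []; have [] := P2 j. Qed.

Lemma Lfun2_rcoord_centered t :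
  (fun d : cvec R N => rcoord t (d - mean P)) \in Lfun P 2%:E.
Proof.
under eq_fun do rewrite rcoordB.
by apply: LfunD_cst; [rewrite ler1n|exact: Lfun2_rcoord].
Qed.

Lemma Lfun2_rlform_centered a :
  (fun d : cvec R N => rlform a (d - mean P)) \in Lfun P 2%:E.
Proof.
apply: (Lfun_lincomb _ _ _ (I := _)) => [|t]; first by rewrite ler1n.
exact: Lfun2_rcoord_centered.
Qed.

Lemma Ex_rcoord_centered t :
  Ex P (fun d : cvec R N => rcoord t (d - mean P)) = 0.
Proof.
under eq_fun do rewrite rcoordB.
rewrite ExD ?Ex_cst ?rcoord_mean ?subrr//; last exact: Lfun_cst.
exact/Lfun21/Lfun2_rcoord.
Qed.

Definition rcov t u : R :=
  Ex P (fun d : cvec R N => rcoord t (d - mean P) * rcoord u (d - mean P)).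

Lemma Lfun1_rcov t u :
  (fun d : cvec R N => rcoord t (d - mean P) * rcoord u (d - mean P))
    \in Lfun P 1%:E.
Proof. by apply: LfunM; exact: Lfun2_rcoord_centered. Qed.

Lemma covariance_mxE j k : covariance_mx P j k =
  ((rcov (j, false) (k, false) + rcov (j, true) (k, true))
   +i* (rcov (j, true) (k, false) - rcov (j, false) (k, true)))%C.
Proof.
rewrite mxE /cexpectation /rcov -ExD -?ExB; try exact: Lfun1_rcov.
congr (_ +i* _)%C; congr fine; congr expectation; apply/funext => d;
  rewrite /rcoord !mxE; case: (d 0 j + _) (d 0 k + _) => ? ? [? ?] /=.
  by rewrite mulrN opprK.
by rewrite mulrN addrC.
Qed.

Lemma pseudo_covariance_mxE j k : pseudo_covariance_mx P j k =
  ((rcov (j, false) (k, false) - rcov (j, true) (k, true))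
   +i* (rcov (j, false) (k, true) + rcov (j, true) (k, false)))%C.
Proof.
rewrite mxE /cexpectation /rcov -ExD -?ExB; try exact: Lfun1_rcov.
by congr (_ +i* _)%C; congr fine; congr expectation; apply/funext => d;
  rewrite /rcoord !mxE; case: (d 0 j + _) (d 0 k + _) => ? ? [? ?] /=.
Qed.

Lemma Ex_rcoord_rlform t a :
  Ex P (fun d : cvec R N => rcoord t (d - mean P) * rlform a (d - mean P)) =
  \sum_u a u * rcov t u.
Proof.
under eq_fun do
  (rewrite mulr_sumr; under eq_bigr do rewrite mulrCA).
by rewrite Ex_lincomb// => u; exact: Lfun1_rcov.
Qed.

Definition rvar a : R := Ex P (fun d : cvec R N => rlform a (d - mean P) ^+ 2).

(** Expanding the square shows that the variance of a real linear form depends on the distribution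
    only through the real covariances. *)
Lemma rvarE a : rvar a = \sum_t a t * \sum_u a u * rcov t u.
Proof.
under eq_bigr do rewrite -Ex_rcoord_rlform.
rewrite -Ex_lincomb => [|t]; last first.
  by apply: LfunM; [exact: Lfun2_rcoord_centered|exact: Lfun2_rlform_centered].
congr fine; congr expectation; apply/funext => d.
by rewrite expr2 {1}/rlform mulr_suml; apply: eq_bigr => t _; rewrite mulrA.
Qed.

Lemma Ex_rlform a : Ex P (fun d : cvec R N => rlform a d) = rlform a (mean P).
Proof.
rewrite Ex_lincomb; first by apply: eq_bigr => t _; rewrite rcoord_mean.
by move=> t; exact/Lfun21/Lfun2_rcoord.
Qed.

Lemma Ex_rlform_centered a :
  Ex P (fun d : cvec R N => rlform a (d - mean P)) = 0.
Proof.
rewrite Ex_lincomb => [|t]; last exact/Lfun21/Lfun2_rcoord_centered.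
by apply: big1 => t _; rewrite Ex_rcoord_centered mulr0.
Qed.

End real_moments.

(** The real and imaginary parts of the two complex entries at [(j, k)] are sums and differences of
    the four real covariances of the coordinates [j] and [k]. This linear system is invertible, so
    covariance and pseudo-covariance together determine the real covariance matrix. *)
Lemma eq_rcov (R : realType) (N : nat) (P Q : cdistribution R N) :
    square_integrable P -> square_integrable Q ->
  covariance_mx P = covariance_mx Q ->
  pseudo_covariance_mx P = pseudo_covariance_mx Q ->
  forall t u, rcov P t u = rcov Q t u.
Proof.
move=> P2 Q2 GPQ JPQ [j b] [k c].
have := congr1 (fun A => fun_of_matrix A j k) GPQ.
have := congr1 (fun A => fun_of_matrix A j k) JPQ.
rewrite !covariance_mxE// !pseudo_covariance_mxE//.
move=> /eqP; rewrite eq_complex/= => /andP[/eqP e1 /eqP e2].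
move=> /eqP; rewrite eq_complex/= => /andP[/eqP e3 /eqP e4].
by case: b c => [] []; lra.
Qed.

Lemma phi_rlform (R : realType) (n : nat) (z : 'cV[R[i]]_n) :
  exists a, forall d : cvec R (n + 1), phi z d = rlform a d.
Proof.
(* The signs come from Re(xy) = Re x Re y - Im x Im y. *)
pose a (t : 'I_(n + 1) * bool) := if t.2 then - complex.Im (ztilde z t.1 0)
                                  else complex.Re (ztilde z t.1 0).
exists a => d.
rewrite /phi mxE (big_morph _ (id1 := 0) (op1 := +%R)); last 2 first.
- by move=> [? ?] [? ?].
- by [].
transitivity (\sum_j \sum_b a (j, b) * rcoord (j, b) d); last first.
  by rewrite pair_bigA; apply: eq_bigr => -[].
apply: eq_bigr => j _; rewrite big_bool /rcoord /a/=.
by case: (d 0 j) (ztilde z j 0) => ? ? [? ?] /=; ring.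
Qed.

(** * Continuity and Borel measurability *)

Section measurability.
Context (R : realType).

Lemma continuous_Re : continuous (@complex.Re R : R[i] -> R).
Proof.
move=> x; apply/(@cvgrPdist_lt _ _ _ (nbhs x)) => e e0.
apply/nbhs_normP; exists e%:C%C => [|y /= xy]; first by rewrite /= ltcR.
have -> : complex.Re x - complex.Re y = complex.Re (x - y).
  by case: x y {xy} => ? ? [].
by rewrite -ltcR; apply: le_lt_trans (normc_ge_Re _) xy.
Qed.

Lemma continuous_Im : continuous (@complex.Im R : R[i] -> R).
Proof.
move=> x.
have -> : @complex.Im R = @complex.Re R \o (fun y => - 'i%C * y) :> (R[i] -> R).
  by apply/funext => -[u v] /=; ring.
apply: continuous_comp; last exact: continuous_Re.
exact: mulrl_continuous.
Qed.

Lemma continuous_real_complex : continuous (fun r : R => r%:C%C : R[i]).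
Proof.
(* In the order of [R[i]], a positive [e] is real, so its real part can serve as the radius. *)
move=> x; apply/cvgrPdist_lt => e; rewrite ltcE => /andP[/eqP e_real e0].
apply/nbhs_normP; exists (complex.Re e) => // y /= xy.
have -> : x%:C%C - y%:C%C = (x - y)%:C%C :> R[i] by rewrite rmorphB.
by rewrite normc_def /= expr0n addr0 sqrtr_sqr ltcE/= e_real eqxx.
Qed.

Context (N : nat).
Implicit Types (t : 'I_N * bool) (a : 'I_N * bool -> R).

Lemma continuous_rcoord t : continuous (rcoord t : 'rV[R[i]]_N -> R).
Proof.
case: t => j b x; rewrite /rcoord /=; case: b => /=.
  apply: (@continuous_comp _ _ _ (fun d : 'rV[R[i]]_N => d 0 j) (@complex.Im R)).
    exact: coord_continuous.
  exact: continuous_Im.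
apply: (@continuous_comp _ _ _ (fun d : 'rV[R[i]]_N => d 0 j) (@complex.Re R)).
  exact: coord_continuous.
exact: continuous_Re.
Qed.

Lemma continuous_rlform a : continuous (rlform a : 'rV[R[i]]_N -> R).
Proof.
have cF t : continuous (fun d : 'rV[R[i]]_N => a t * rcoord t d).
  move=> x; apply: (@continuous_comp _ _ _ (rcoord t) ( *%R (a t))).
    exact: continuous_rcoord.
  exact: mulrl_continuous.
exact: (@continuous_big R _ _ 0 xpredT (@add_continuous R) _ _ _
  (fun t _ => cF t)).
Qed.

Lemma measurable_continuous (f : 'rV[R[i]]_N -> R) :
  continuous f -> measurable_fun setT (f : cvec R N -> R).
Proof.
move=> cf; apply: (measurability _ (RGenOpens.measurableE R)).
move=> _ [_ [a [b ->] <-]]; rewrite setTI.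
apply: sub_sigma_algebra.
by apply: open_comp; [move=> ? _; exact: cf|exact: interval_open].
Qed.

Lemma measurable_continuous_cvec (f : 'rV[R[i]]_N -> 'rV[R[i]]_N) :
  continuous f -> measurable_fun setT (f : cvec R N -> cvec R N).
Proof.
move=> cf.
apply: (@measurability _ _ (cvec R N) (cvec R N) setT f
  (@open 'rV[R[i]]_N)) => //.
move=> _ [B oB <-]; rewrite setTI.
apply: sub_sigma_algebra.
by apply: open_comp => // ? _; exact: cf.
Qed.

Lemma measurable_rlform a :
  measurable_fun setT (fun d : cvec R N => rlform a d).
Proof. by apply: measurable_continuous; exact: continuous_rlform. Qed.

End measurability.

(** * One-sided Chebyshev inequality for symmetric distributions *)

Section symmetric_chebyshev.
Context (R : realType) (N : nat) (P : cdistribution R N).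
Hypothesis P2 : square_integrable P.
Implicit Types (a : 'I_N * bool -> R).

Lemma measurable_rlformB a x :
  measurable_fun setT (fun d : cvec R N => rlform a (d - x)).
Proof.
under eq_fun do rewrite rlformB.
by apply: measurable_funB => //; exact: measurable_rlform.
Qed.

Lemma measurable_rlform_itv a x (I : interval R) :
  measurable [set d : cvec R N | rlform a (d - x) \in I].
Proof.
by have := measurable_rlformB a x measurableT (measurable_itv I); rewrite setTI.
Qed.

Lemma measurable_rlform_gt a x (c : R) :
  measurable [set d : cvec R N | c < rlform a (d - x)].
Proof.
have := measurable_rlform_itv a x `]c, +oo[.
by under eq_set do rewrite in_itv/= andbT.
Qed.

Lemma measurable_rlform_lt a x (c : R) :
  measurable [set d : cvec R N | rlform a (d - x) < c].
Proof. exact: (measurable_rlform_itv a x `]-oo, c[). Qed.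

Lemma measurable_rlform_le a x (c : R) :
  measurable [set d : cvec R N | rlform a (d - x) <= c].
Proof. exact: (measurable_rlform_itv a x `]-oo, c]). Qed.

Lemma Lfun2_rlform a : (fun d : cvec R N => rlform a d) \in Lfun P 2%:E.
Proof.
by apply: Lfun_lincomb => [|t]; [rewrite ler1n|exact: Lfun2_rcoord].
Qed.

Lemma variance_rlform a :
  variance P (fun d : cvec R N => rlform a d) = (rvar P a)%:E.
Proof.
rewrite -[LHS]fineK; last exact/variance_fin_num/Lfun2_rlform.
congr (_%:E); rewrite /variance unlock Ex_rlform//.
congr fine; congr expectation; apply/funext => d /=.
by rewrite rlformB expr2.
Qed.

Lemma rvar_ge0 a : 0 <= rvar P a.
Proof. by rewrite -lee_fin -variance_rlform variance_ge0. Qed.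

Lemma chebyshev_rlform a (c : R) : 0 < c ->
  (P [set d : cvec R N | (c <= `|rlform a (d - mean P)|)%R]
   <= (rvar P a / c ^+ 2)%:E)%E.
Proof.
move=> c0.
pose X := @isMeasurableFun.Build _ _ _ _ _ (@measurable_rlform R N a).
pose Y : {mfun cvec R N >-> R} := HB.pack (fun d : cvec R N => rlform a d) X.
have := @chebyshev _ _ _ P Y c c0.
rewrite -[variance P _]/(variance P (fun d : cvec R N => rlform a d)).
rewrite -[Ex P _]/(Ex P (fun d : cvec R N => rlform a d)).
rewrite Ex_rlform// variance_rlform -EFinM mulrC; apply: le_trans.
by under eq_set do rewrite rlformB.
Qed.

(** Covers the degenerate case: the squared centred form is nonnegative with zero integral, hence
    zero almost everywhere. *)
Lemma rvar_eq0_ae a : rvar P a = 0 ->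
  P [set d : cvec R N | 0 < rlform a (d - mean P)] = 0%E.
Proof.
move=> v0; set A := [set d | _].
have mA : measurable A by exact: measurable_rlform_gt.
pose f (d : cvec R N) := (rlform a (d - mean P) ^+ 2)%:E.
have mf : measurable_fun setT f.
  by apply/measurable_EFinP; apply: measurable_funX; exact: measurable_rlformB.
have f_int0 : (\int[P]_d `|f d| = 0)%E.
  under eq_integral do rewrite gee0_abs ?lee_fin ?sqr_ge0//.
  move: v0; rewrite /rvar unlock -/f => v0.
  (* [fine] also sends infinite values to 0; square integrability excludes them, so the integral
     itself vanishes. *)
  rewrite -[LHS]fineK ?v0//; apply: integrable_fin_num => //.
  exact: Lfun2_integrable_sqr (Lfun2_rlform_centered P2 a).
apply/(negligibleP _ mA).
apply: negligibleS ((ae_eq_integral_abs P measurableT mf).1 f_int0).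
by move=> d /= fd0 /(_ I)[]/eqP; rewrite sqrf_eq0 gt_eqF.
Qed.

Hypothesis P_sym : symmetric_around_mean P.

(** Negation exchanges the half-spaces [c < rlform a x] and [rlform a x < - c], and the centred law
    is invariant under negation. *)
Lemma symmetric_tail a (c : R) :
  P [set d : cvec R N | rlform a (d - mean P) < - c] =
  P [set d : cvec R N | c < rlform a (d - mean P)].
Proof.
have := measurable_rlform_gt a 0 c; under eq_set do rewrite subr0.
move=> /P_sym; rewrite /pushforward => /esym.
congr (P _ = P _); apply/seteqP; split => d /=.
  by move=> [x cx <-]; rewrite rlformN ltrN2.
by exists (- (d - mean P)); rewrite ?opprK// rlformN ltrNr.
Qed.

Lemma symmetric_chebyshev a (c : R) : 0 < c ->
  (P [set d : cvec R N | (c < rlform a (d - mean P))%R]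
   <= (rvar P a / (2 * c ^+ 2))%:E)%E.
Proof.
move=> c0; have := chebyshev_rlform a c0.
set A := [set d | _] => PA.
pose U := [set d : cvec R N | c < rlform a (d - mean P)].
pose V := [set d : cvec R N | rlform a (d - mean P) < - c].
have mU : measurable U by exact: measurable_rlform_gt.
have mV : measurable V by exact: measurable_rlform_lt.
have mA : measurable A.
  rewrite (_ : A = ~` [set d : cvec R N | rlform a (d - mean P) \in `]- c, c[]).
    by apply: measurableC; exact: measurable_rlform_itv.
  apply/seteqP; split => d; rewrite /A/= in_itv/= -ltr_norml leNgt => /negP//.
have UV : (P U + P V <= P A)%E.
  rewrite -measureU//.
    apply: le_measure; rewrite ?inE//; first exact: measurableU.
    move=> d [] /= cd; apply: ltW.
      by rewrite (lt_le_trans cd)// ler_norm.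
    by rewrite -normrN (lt_le_trans _ (ler_norm _))// ltrNr.
  apply/seteqP; split => // d [] /= cd dc.
  by have := lt_trans cd dc; lra.
have := le_trans UV PA.
rewrite -/U /V symmetric_tail -/U -(fineK (fin_num_measure P U mU)).
rewrite -EFinD !lee_fin.
rewrite invfM mulrCA => UU; lra.
Qed.

End symmetric_chebyshev.

(** * Sufficiency for a single distribution *)

Lemma chance_constraint_sufficient (R : realType) (N : nat)
    (P : cdistribution R N) (a : 'I_N * bool -> R) (p : R) :
    square_integrable P -> symmetric_around_mean P -> p < 1 ->
    kfactor p * Num.sqrt (rvar P a) + rlform a (mean P) <= 0 ->
  (p%:E <= P [set d : cvec R N | (rlform a d <= 0)%R])%E.
Proof.
move=> P2 P_sym p1; set m := rlform a (mean P); set v := rvar P a => kvm.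
have v0 : 0 <= v by exact: rvar_ge0.
set U := [set d : cvec R N | - m < rlform a (d - mean P)].
have mU : measurable U by exact: measurable_rlform_gt.
rewrite (_ : [set _ | _] = ~` U); last first.
  apply/seteqP; split => d; rewrite /U/= rlformB ltrBrDr addNr leNgt.
    by move/negP.
  by move/negP.
suff PU : (P U <= (1 - p)%:E)%E.
  rewrite probability_setC// leeBrDr ?fin_num_measure//.
  move: PU; rewrite -(fineK (fin_num_measure P U mU)) -EFinD !lee_fin; lra.
pose r := Num.sqrt (2 * (1 - p)).
have r0 : 0 < r by rewrite sqrtr_gt0; lra.
have s0 : 0 <= Num.sqrt v by exact: sqrtr_ge0.
have kv0 : 0 <= kfactor p * Num.sqrt v by rewrite mulr_ge0// invr_ge0 ltW.
(* As [kfactor p * Num.sqrt v] is nonnegative, the hypothesis excludes [m > 0]. For [m < 0]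
   Chebyshev applies at distance [- m], and squaring the hypothesis bounds [v / (2 * m ^+ 2)] by
   [1 - p]. For [m = 0] there is no positive distance, but the variance must vanish. *)
have [m0|m0|m0] := ltgtP m 0.
- apply: (le_trans (symmetric_chebyshev P2 P_sym a _)).
    by rewrite oppr_gt0.
  have svr : Num.sqrt v <= - m * r.
    by rewrite -ler_pdivrMr// mulrC; rewrite /kfactor -/r in kvm; lra.
  have : Num.sqrt v ^+ 2 <= (- m * r) ^+ 2.
    by rewrite lerXn2r ?nnegrE//; apply: mulr_ge0; lra.
  rewrite exprMn !sqr_sqrtr//; last lra.
  rewrite -/v lee_fin => vm; rewrite ler_pdivrMr; first by lra.
  by rewrite mulr_gt0// exprn_gt0// oppr_gt0.
- by exfalso; lra.
- have v_eq0 : v = 0.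
    apply/eqP; rewrite eq_le v0 andbT -sqrtr_eq0.
    move: kvm; rewrite m0 addr0 pmulr_rle0 ?invr_gt0// => sv0.
    by rewrite eq_le sv0 s0.
  rewrite /U m0 oppr0 (rvar_eq0_ae P2 v_eq0) lee_fin; lra.
Qed.

(** * Displacement along the regression vector *)

Section displacement.
Context (R : realType) (N : nat) (Q : cdistribution R N).
Hypotheses (Q2 : square_integrable Q) (Q_sym : symmetric_around_mean Q).
Context (a : 'I_N * bool -> R).
Hypothesis v_neq0 : rvar Q a != 0.
Implicit Types (t u : 'I_N * bool) (s : R).

(** The least-squares slope of coordinate [t] against [rlform a]; the numerator is their covariance
    by [Ex_rcoord_rlform]. *)
Let slope t : R := (\sum_u a u * rcov Q t u) / rvar Q a.

Definition regression : 'rV[R[i]]_N :=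
  \row_j (slope (j, false) +i* slope (j, true))%C.

Let rcoord_regression t : rcoord t regression = slope t.
Proof. by case: t => j []; rewrite /rcoord mxE. Qed.

(** Applying the form to the slopes gives its covariance with itself over its variance. *)
Let rlform_regression : rlform a regression = 1.
Proof.
rewrite /rlform; under eq_bigr do rewrite rcoord_regression /slope mulrA.
by rewrite -mulr_suml -rvarE// divff.
Qed.

(* Moves [x] along the regression vector to where [rlform a] is
   [rlform a (mean Q) + s]. *)
Definition displace s (x : 'rV[R[i]]_N) : 'rV[R[i]]_N :=
  x + (s - rlform a (x - mean Q))%:C%C *: regression.

Lemma rlform_displace s x : rlform a (displace s x) = rlform a (mean Q) + s.
Proof.
by rewrite rlformD rlformZ rlform_regression mulr1 rlformB; ring.
Qed.

Lemma continuous_displace s : continuous (displace s).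
Proof.
move=> x; apply: (@cvgD _ _ _ (nbhs x) _ id); first exact: (@cvg_id _ (nbhs x)).
apply: cvgZr_tmp.
have cont : continuous (fun x : 'rV[R[i]]_N => s - rlform a (x - mean Q)).
  move=> y; under eq_fun do rewrite rlformB opprB addrA.
  apply: (@cvgB _ _ _ (nbhs y) _ (cst _) (rlform a)).
    exact: (@cvg_cst _ _ _ (nbhs y)).
  exact: (@continuous_rlform R N a y).
apply: (@continuous_comp _ _ _
  (fun x : 'rV[R[i]]_N => s - rlform a (x - mean Q))
  (fun r : R => r%:C%C : R[i])); first exact: cont.
exact: continuous_real_complex.
Qed.

Lemma measurable_displace s :
  measurable_fun setT (displace s : cvec R N -> cvec R N).
Proof. by apply: measurable_continuous_cvec; exact: continuous_displace. Qed.

Lemma rcoord_displace t s x : rcoord t (displace s x - mean Q) =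
  rcoord t (x - mean Q) + (s - rlform a (x - mean Q)) * rcoord t regression.
Proof. by rewrite /displace addrAC [LHS]rcoordD rcoordZ. Qed.

Lemma Lfun2_displace t s :
  (fun d : cvec R N => rcoord t (displace s d - mean Q)) \in Lfun Q 2%:E.
Proof.
under eq_fun do rewrite rcoord_displace mulrC -[s - _]opprB mulrN -mulNr.
apply: LfunD; rewrite ?ler1n//; first exact: Lfun2_rcoord_centered.
apply: LfunZ; rewrite ?ler1n//; apply: LfunD_cst; rewrite ?ler1n//.
exact: Lfun2_rlform_centered.
Qed.

Lemma Ex_displace t s :
  Ex Q (fun d : cvec R N => rcoord t (displace s d - mean Q)) =
  s * rcoord t regression.
Proof.
have L1 := Lfun21 (Lfun2_rcoord_centered Q2 t).
have L2 := Lfun21 (Lfun2_rlform_centered Q2 a).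
rewrite (_ : (fun d => _) = (fun d : cvec R N => rcoord t (d - mean Q) +
  (- rcoord t regression * rlform a (d - mean Q) + s * rcoord t regression))).
  rewrite !ExD ?ExZ ?Ex_cst ?Ex_rcoord_centered ?Ex_rlform_centered//.
  - by rewrite mulr0 !add0r.
  - exact: Lfun_cst.
  - exact: LfunZ.
  - exact: Lfun_cst.
  - by apply: LfunD => //; [exact: LfunZ|exact: Lfun_cst].
by apply/funext => d; rewrite rcoord_displace; ring.
Qed.

(** A displaced centred coordinate is its regression residual plus [s] times its slope. The
    residuals have mean zero and covariance [rcov Q t u] minus [rvar Q a] times the product of
    slopes; the constant parts add [s ^+ 2] times that product. The proof checks this by full
    expansion. *)
Lemma Ex_displaceM t u s :
  Ex Q (fun d : cvec R N =>
    rcoord t (displace s d - mean Q) * rcoord u (displace s d - mean Q)) =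
  rcov Q t u +
  (s ^+ 2 - rvar Q a) * (rcoord t regression * rcoord u regression).
Proof.
pose g t := rcoord t regression.
pose x t := fun d : cvec R N => rcoord t (d - mean Q).
pose y := fun d : cvec R N => rlform a (d - mean Q).
have x1 t' : x t' \in Lfun Q 1%E by exact/Lfun21/Lfun2_rcoord_centered.
have y1 : y \in Lfun Q 1%E by exact/Lfun21/Lfun2_rlform_centered.
have xy1 t' : (fun d => x t' d * y d) \in Lfun Q 1%E.
  by apply: LfunM; [exact: Lfun2_rcoord_centered|exact: Lfun2_rlform_centered].
have yy1 : (fun d => y d ^+ 2) \in Lfun Q 1%E.
  by under eq_fun do rewrite expr2; apply: LfunM; exact: Lfun2_rlform_centered.
have xx1 : (fun d => x t d * x u d) \in Lfun Q 1%E by exact: Lfun1_rcov.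
have xyE t' : Ex Q (fun d => x t' d * y d) = rvar Q a * g t'.
  by rewrite Ex_rcoord_rlform// /g rcoord_regression /slope mulrC divfK.
rewrite (_ : (fun d => _) = (fun d => x t d * x u d + (- g u * (x t d * y d) +
  (- g t * (x u d * y d) + ((g t * g u) * y d ^+ 2 + ((s * g u) * x t d +
  ((s * g t) * x u d + ((- 2 * s * g t * g u) * y d + s ^+ 2 * g t * g u)))))))).
  rewrite !ExD ?ExZ//; try by do ?[apply: LfunD|apply: LfunZ|apply: Lfun_cst].
  rewrite Ex_cst !xyE !Ex_rcoord_centered// Ex_rlform_centered//.
  by rewrite -/(rcov Q t u) -/(rvar Q a) /g; ring.
apply/funext => d; rewrite !rcoord_displace -/(x t d) -/(x u d) -/(y d) /g.
by ring.
Qed.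

(** Point reflection through the mean turns the displacement by [s] into the displacement by [- s]
    ([reflect]), so the symmetry of [Q] exchanges the two while reflecting [B]. *)
Lemma displace_symmetric s (B : set (cvec R N)) : measurable B ->
  Q [set d | B (displace s d - mean Q)] =
  Q [set d | [set - (x : 'rV_N) | x in B] (displace (- s) d - mean Q)].
Proof.
move=> mB.
have shift_cont (y : 'rV[R[i]]_N) : continuous (fun x : 'rV[R[i]]_N => x + y).
  move=> x; apply: (@cvgD _ _ _ (nbhs x) _ id).
    exact: (@cvg_id _ (nbhs x)).
  exact: (@cvg_cst _ _ _ (nbhs x)).
(* [h] is the displacement in coordinates centred at the mean, where [Q_sym] applies to the preimage
   of [B]. *)
pose h := (fun x => x - mean Q) \o (displace s \o (fun x => x + mean Q)).
have mh : measurable_fun setT (h : cvec R N -> cvec R N).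
  apply: measurable_continuous_cvec => x.
  apply: continuous_comp; last exact: shift_cont.
  by apply: continuous_comp; [exact: shift_cont|exact: continuous_displace].
have := mh measurableT _ mB; rewrite setTI => /Q_sym; rewrite /pushforward.
have reflect (x : 'rV[R[i]]_N) :
    displace (- s) (mean Q - x) - mean Q = - (displace s (x + mean Q) - mean Q).
  have mx : mean Q - x - mean Q = - x by rewrite addrAC subrr add0r.
  rewrite /displace addrAC mx addrK rlformN opprK [in RHS]addrAC addrK.
  by rewrite opprD -scaleNr -rmorphN opprB addrC [- s + _]addrC [RHS]addrC.
congr (Q _ = Q _).
  by apply/seteqP; split => d; rewrite /h/= [d - _ + _]subrK.
apply/seteqP; split => d /=; rewrite /h/=.
  move=> [x Bx xd]; exists (displace s (x + mean Q) - mean Q) => //.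
  by rewrite -reflect xd [mean Q + _]addrC subrK.
move=> [x Bx xd]; exists (mean Q - d); last by rewrite opprB.
by have := reflect (mean Q - d); rewrite subKr -xd => /oppr_inj <-.
Qed.

End displacement.

(** * Extremal distributions and necessity *)

Lemma extremal_distribution (R : realType) (N : nat) (Q : cdistribution R N)
    (a : 'I_N * bool -> R) (q s : R) :
    square_integrable Q -> symmetric_around_mean Q -> rvar Q a != 0 ->
    0 <= q -> 2 * q <= 1 -> 2 * q * s ^+ 2 = rvar Q a ->
    0 < rlform a (mean Q) + s ->
  exists P : cdistribution R N,
    [/\ square_integrable P, symmetric_around_mean P, mean P = mean Q,
        forall t u, rcov P t u = rcov Q t u &
        (P [set d : cvec R N | (rlform a d <= 0)%R] <= (1 - q)%:E)%E].
Proof.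
move=> Q2 Q_sym v_neq0 q0 q1 qs ms.
pose X r : {mfun cvec R N >-> cvec R N} :=
  HB.pack (displace Q a r : cvec R N -> cvec R N)
    (isMeasurableFun.Build _ _ _ _ _ (measurable_displace Q a r)).
have [P [PE LfunP ExP]] := three_point_mixture Q (X s) (X 0) (X (- s)) q0 q1.
have {}ExP (f : cvec R N -> R) : measurable_fun setT f ->
    (forall r, (fun d => f (displace Q a r d)) \in Lfun Q 1%E) ->
    Ex P f = q * Ex Q (fun d => f (displace Q a s d)) +
     ((1 - 2 * q) * Ex Q (fun d => f (displace Q a 0 d)) +
      q * Ex Q (fun d => f (displace Q a (- s) d))).
  by move=> mf Qf; exact: (ExP f mf (Qf s) (Qf 0) (Qf (- s))).
have {}PE (A : set (cvec R N)) : P A =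
    (q%:E * Q [set d | A (displace Q a s d)] +
     ((1 - 2 * q)%:E * Q [set d | A (displace Q a 0 d)] +
      q%:E * Q [set d | A (displace Q a (- s) d)]))%E by exact: PE.
have mcoord t x : measurable_fun setT (fun d : cvec R N => rcoord t (d - x)).
  under eq_fun do rewrite rcoordB; apply: measurable_funB => //.
  by apply: measurable_continuous; exact: continuous_rcoord.
have mcoord0 t : measurable_fun setT (fun d : cvec R N => rcoord t d).
  by apply: measurable_continuous; exact: continuous_rcoord.
have L2 t r : (fun d : cvec R N => rcoord t (displace Q a r d - mean Q))
    \in Lfun Q 2%:E by exact: Lfun2_displace.
have L2' t r : (fun d : cvec R N => rcoord t (displace Q a r d))
    \in Lfun Q 2%:E.
  rewrite (_ : (fun d => _) = (fun d : cvec R N =>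
    rcoord t (displace Q a r d - mean Q) + rcoord t (mean Q))).
    by apply: LfunD_cst; [rewrite ler1n|exact: L2].
  by apply/funext => d; rewrite rcoordB subrK.
have P2 : square_integrable P.
  suff PX t : (fun d : cvec R N => rcoord t d) \in Lfun P 2%:E.
    by move=> j; split; [exact: (PX (j, false))|exact: (PX (j, true))].
  by apply: LfunP; [rewrite ler1n|exact: mcoord0|exact: L2'..].
have meanP : mean P = mean Q.
  apply: rcoord_inj => t; apply/eqP; rewrite -subr_eq0 [X in X - _]rcoord_mean.
  rewrite -(Ex_cst P (rcoord t (mean Q))) -ExB; last 2 first.
  - exact/Lfun21/(Lfun2_rcoord P2).
  - exact: Lfun_cst.
  under eq_fun do rewrite -rcoordB.
  pose g := rcoord t (regression Q a).
  rewrite (_ : Ex P _ = q * (s * g) + ((1 - 2 * q) * (0 * g) + q * (- s * g))).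
    by apply/eqP; ring.
  rewrite ExP; last 2 first.
  - exact: mcoord.
  - by move=> r; exact/Lfun21/L2.
  by congr (_ * _ + (_ * _ + _ * _)); exact: Ex_displace.
exists P; split => //.
- move=> A mA; rewrite /pushforward meanP.
  pose F r B := Q [set d | B (displace Q a r d - mean Q)].
  have PF (B : set (cvec R N)) : P [set d | B (d - mean Q)] =
      (q%:E * F s B + ((1 - 2 * q)%:E * F 0%R B + q%:E * F (- s)%R B))%E.
    exact: PE.
  (* Reflection swaps the branches [s] and [- s], of equal weight [q], and preserves the branch
     0. *)
  have F_opp r : F r A = F (- r) [set - (x : 'rV_N) | x in A].
    exact: displace_symmetric.
  rewrite [LHS]PF [RHS]PF !F_opp oppr0 opprK.
  move: (F s _) (F 0%R _) (F (- s) _) => x y w.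
  by rewrite addeCA [RHS]addeCA [(_ * w + _)%E]addeC.
- move=> t u; rewrite /rcov meanP; pose c := rcov Q t u.
  pose g := rcoord t (regression Q a) * rcoord u (regression Q a).
  (* The corrections from [Ex_displaceM] average to [2 * q * s ^+ 2 - rvar Q a], which is zero by
     [qs]. *)
  rewrite (_ : Ex P _ = q * (c + (s ^+ 2 - rvar Q a) * g) +
    ((1 - 2 * q) * (c + (0 ^+ 2 - rvar Q a) * g) +
     q * (c + ((- s) ^+ 2 - rvar Q a) * g))).
    by rewrite -[RHS]/c -qs; ring.
  rewrite ExP; last 2 first.
  + exact: measurable_funM.
  + by move=> r; apply: LfunM; exact: L2.
  by congr (_ * _ + (_ * _ + _ * _)); exact: Ex_displaceM.
(* On the branch [s] the form is constant and positive, so the event has no mass there; the other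
   two branches have total weight [1 - q]. *)
- pose U r := [set d : cvec R N | rlform a (displace Q a r d) <= 0].
  have Us : Q (U s) = 0%E.
    rewrite (_ : U s = set0); first exact: measure0.
    by apply/seteqP; split => // d; rewrite /U/= rlform_displace// leNgt ms.
  have mle : measurable [set d : cvec R N | rlform a d <= 0].
    have := measurable_rlform_le a (0 : 'rV[R[i]]_N) 0.
    by under eq_set do rewrite subr0.
  have U1 r : (Q (U r) <= 1)%E.
    apply: probability_le1.
    by have := measurable_displace Q a r measurableT mle; rewrite setTI.
  have -> : P [set d : cvec R N | (rlform a d <= 0)%R] =
      ((1 - 2 * q)%:E * Q (U 0%R) + q%:E * Q (U (- s)%R))%E.
    by rewrite -[RHS]add0e -[X in (X + _)%E](mule0 q%:E) -Us; exact: PE.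
  have -> : (1 - q)%:E = ((1 - 2 * q)%:E * 1 + q%:E * 1)%E.
    by rewrite !mule1 -EFinD; congr EFin; ring.
  by apply: leeD; (apply: lee_wpmul2l; [rewrite lee_fin; lra|exact: U1]).
Qed.

Lemma chance_constraint_necessary (R : realType) (N : nat)
    (Q : cdistribution R N) (a : 'I_N * bool -> R) (p : R) :
    square_integrable Q -> symmetric_around_mean Q -> 1 / 2 < p < 1 ->
    0 < kfactor p * Num.sqrt (rvar Q a) + rlform a (mean Q) ->
  exists P : cdistribution R N,
    [/\ square_integrable P, symmetric_around_mean P, mean P = mean Q,
        forall t u, rcov P t u = rcov Q t u &
        (P [set d : cvec R N | (rlform a d <= 0)%R] < p%:E)%E].
Proof.
move=> Q2 Q_sym /andP[p12 p1]; set m := rlform a (mean Q).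
have [v0|v_neq0] := eqVneq (rvar Q a) 0.
  rewrite v0 sqrtr0 mulr0 add0r => m0; exists Q; split => //.
  (* With zero variance [Q] itself is the witness: since [m > 0], the event lies in the open lower
     tail of the centred form, which is null by symmetry. *)
  apply: (@le_lt_trans _ _ 0%E); last by rewrite lte_fin; lra.
  rewrite -(rvar_eq0_ae Q2 v0) -(symmetric_tail Q_sym a 0).
  rewrite (_ : [set d | _] =
    [set d : cvec R N | rlform a (d - mean Q) <= - m]); last first.
    by apply/seteqP; split => d /=; rewrite rlformB -/m lerBlDr addNr.
  apply: le_measure; rewrite ?inE; first exact: measurable_rlform_le.
    exact: measurable_rlform_lt.
  by move=> d /=; lra.
set sd := Num.sqrt (rvar Q a) => kvm.
have v_gt0 : 0 < rvar Q a by rewrite lt_neqAle eq_sym v_neq0 rvar_ge0.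
have sd0 : 0 < sd by rewrite sqrtr_gt0.
have sdE : sd ^+ 2 = rvar Q a by rewrite sqr_sqrtr// ltW.
set k := kfactor p in kvm.
have k0 : 0 < k by rewrite invr_gt0 sqrtr_gt0; lra.
have kE : k ^+ 2 = (2 * (1 - p))^-1 by rewrite exprVn sqr_sqrtr//; lra.
(* The strict bound [1 / 2 < p] gives [k > 1], which leaves room for [s] strictly between [sd] and
   [k * sd]. *)
have k1 : 1 < k.
  rewrite -(@ltr_pXn2r _ 2)// ?nnegrE ?ltW// expr1n kE invf_gt1; lra.
(* [s] is the midpoint of [b] and [k * sd]. Then [s > sd] yields [2 * q <= 1], [s > - m] makes the
   form positive on the branch [s], and [s < k * sd] yields [q > 1 - p]. *)
pose b := Num.max sd (- m); pose s := (b + k * sd) / 2.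
have b_lt : b < k * sd by rewrite /b gt_max ltr_pMl// k1/=; lra.
have [sd_le m_le] : sd <= b /\ - m <= b by rewrite /b !le_max !lexx orbT.
have s_lt : s < k * sd by rewrite /s; lra.
have s_gt : b < s by rewrite /s; lra.
have s0 : 0 < s by lra.
have s2 : 0 < s ^+ 2 by rewrite exprn_gt0.
pose q := rvar Q a / (2 * s ^+ 2).
have qs : 2 * q * s ^+ 2 = rvar Q a by rewrite /q; field; rewrite gt_eqF.
have vs : rvar Q a <= s ^+ 2 by rewrite -sdE lerXn2r ?nnegrE ?ltW//; lra.
have sv : s ^+ 2 < rvar Q a / (2 * (1 - p)).
  by rewrite -kE -sdE mulrC -exprMn ltr_pXn2r ?nnegrE ?ltW//; lra.
have [] := @extremal_distribution R N Q a q s Q2 Q_sym v_neq0 _ _ qs.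
- by rewrite /q divr_ge0 ?ltW//; lra.
- by rewrite -(ler_pM2r s2) qs mul1r.
- by rewrite -/m; lra.
move=> P [P2 P_sym meanP covP PA]; exists P; split => //.
apply: le_lt_trans PA _; rewrite lte_fin.
move: sv; rewrite -qs ltr_pdivlMr; last by lra.
by rewrite mulrC ltr_pM2r//; lra.
Qed.

(** * From a single distribution to the whole family *)

Lemma eq_rvar (R : realType) (N : nat) (P Q : cdistribution R N)
    (a : 'I_N * bool -> R) :
    square_integrable P -> square_integrable Q ->
  (forall t u, rcov P t u = rcov Q t u) -> rvar P a = rvar Q a.
Proof.
move=> P2 Q2 PQ; rewrite !rvarE//; apply: eq_bigr => t _; congr (_ * _).
by apply: eq_bigr => u _; rewrite PQ.
Qed.

Lemma robust_chance_constraint_sufficient (R : realType) (n : nat)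
    (z : 'cV[R[i]]_n) (mu : 'rV[R[i]]_(n + 1)) (Gamma J : 'M[R[i]]_(n + 1))
    (Q : cdistribution R (n + 1)) (p : R) :
    symmetric_family mu Gamma J Q -> p < 1 ->
    kfactor p * phi_std Q z + phi_mean Q z <= 0 ->
  (p%:E <= worst_case_probability (symmetric_family mu Gamma J) z)%E.
Proof.
move=> [Q2 _ Qm QG QJ] p1; have [a phiE] := phi_rlform z.
rewrite /phi_std /phi_mean (funext phiE) variance_rlform// Ex_rlform// => kvm.
apply/ereal_infP => _ [P [P2 P_sym Pm PG PJ] <-].
rewrite (_ : [set d | _] = [set d : cvec R (n + 1) | rlform a d <= 0]);
  last first.
  by apply/seteqP; split => d /=; rewrite phiE.
apply: chance_constraint_sufficient => //.
(* The criterion is known under [Q]; it transfers to [P] because the prescribed moments fix both the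
   mean and the variance of the form. *)
rewrite (@eq_rvar _ _ P Q) ?Pm ?Qm -?Qm//.
by apply: eq_rcov => //; [rewrite PG|rewrite PJ].
Qed.

(** If the inequality failed, the violating distribution built from [Q] would belong to the same
    family, since its covariance and pseudo-covariance are recovered from the preserved real
    covariances. *)
Lemma robust_chance_constraint_necessary (R : realType) (n : nat)
    (z : 'cV[R[i]]_n) (mu : 'rV[R[i]]_(n + 1)) (Gamma J : 'M[R[i]]_(n + 1))
    (Q : cdistribution R (n + 1)) (p : R) :
    symmetric_family mu Gamma J Q -> 1 / 2 < p < 1 ->
    (p%:E <= worst_case_probability (symmetric_family mu Gamma J) z)%E ->
  kfactor p * phi_std Q z + phi_mean Q z <= 0.
Proof.
move=> [Q2 Q_sym Qm QG QJ] p01; have [a phiE] := phi_rlform z.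
rewrite /phi_std /phi_mean (funext phiE) variance_rlform// Ex_rlform//.
move=> pP; rewrite leNgt; apply/negP => kvm.
have [P [P2 P_sym Pm Pcov]] := chance_constraint_necessary Q2 Q_sym p01 kvm.
apply/negP; rewrite -leNgt; apply: le_trans pP _.
apply: ereal_inf_lbound; exists P.
  split => //; first by rewrite Pm.
  - rewrite -QG; apply/matrixP => j k.
    by rewrite !covariance_mxE// !Pcov.
  - rewrite -QJ; apply/matrixP => j k.
    by rewrite !pseudo_covariance_mxE// !Pcov.
by congr (P _); apply/seteqP; split => d /=; rewrite phiE.
Qed.

(* [Q i] is an arbitrary member of the (nonempty) i-th family: the mean and
   standard deviation of [phi z] may be computed under any member.
   At the endpoint [p i = 1/2] the constraint does not imply the inequality
   (take [phi z] symmetric around 0 and nonconstant), so only the converse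
   implication is claimed there. *)
Theorem theorem5p3 (R : realType) (n m : nat) (z : 'cV[R[i]]_n)
    (mu : 'I_m -> 'rV[R[i]]_(n + 1)) (Gamma J : 'I_m -> 'M[R[i]]_(n + 1))
    (Q : 'I_m -> cdistribution R (n + 1))
    (hQ : forall i, symmetric_family (mu i) (Gamma i) (J i) (Q i))
    (p : 'I_m -> R) (hp : forall i, 1 / 2 <= p i < 1) :
  ((forall i, 1 / 2 < p i) ->
    (forall i, ((p i)%:E <=
       worst_case_probability (symmetric_family (mu i) (Gamma i) (J i)) z)%E)
    <->
    (forall i, kfactor (p i) * phi_std (Q i) z + phi_mean (Q i) z <= 0))
  /\
  ((forall i, kfactor (p i) * phi_std (Q i) z + phi_mean (Q i) z <= 0) ->
    (forall i, ((p i)%:E <=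
       worst_case_probability (symmetric_family (mu i) (Gamma i) (J i)) z)%E)).
Proof.
have suff_i :
    (forall i, kfactor (p i) * phi_std (Q i) z + phi_mean (Q i) z <= 0) ->
    forall i, ((p i)%:E <=
      worst_case_probability (symmetric_family (mu i) (Gamma i) (J i)) z)%E.
  move=> kle i; have /andP[_ p1] := hp i.
  by apply: robust_chance_constraint_sufficient (hQ i) p1 (kle i).
split => // p12; split => // pP i; have /andP[_ p1] := hp i.
by apply: robust_chance_constraint_necessary (hQ i) _ (pP i); rewrite p12.
Qed.
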